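(* Let $V$ be a finite dimensional vector space over a field $\mathbb{K}$ of characteristic zero. Suppose $z\in\widehat L(V)$ has non-trivial linear term, i.e. $z\notin\prod_{l>1}(\widehat L(V)\cap V^{\otimes l})$, and $a\in\widehat L(V)$ satisfies $|\exp(a)|=|\exp(z)|\in|\widehat T(V)|$. Then $a=gzg^{-1}$ for some group-like element $g\in\exp(\widehat L(V))$.
   Context: $\widehat T(V)=\prod_{m\ge0}V^{\otimes m}$ is the completed tensor algebra, a complete Hopf algebra with $V$ primitive; $\widehat L(V)$ is the completed free Lie algebra on $V$ (its primitive elements); $\exp(\widehat L(V))$ is the group of group-like elements. $|\widehat T(V)|$ is the quotient by the closure of the span of commutators, with projection $x\mapsto|x|$. *)

(* Defs.v *)
(* The finite-dimensional space V over K is identified with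
   K^n via a basis indexed by 'I_n; V^{(x)m} then has basis the words of
   length m over 'I_n, and the completed tensor algebra
   \widehat T(V) = prod_m V^{(x)m} is the space of all functions
   seq 'I_n -> K (non-commutative formal power series). *)
From mathcomp Require Import all_boot all_order all_algebra.
Set Implicit Arguments. Unset Strict Implicit. Unset Printing Implicit Defensive.
Import Order.TTheory GRing.Theory Num.Theory.
Local Open Scope ring_scope.

Section Tensor.
Variables (K : fieldType) (n : nat).

Definition series := seq 'I_n -> K.

Definition one_s : series := fun w => (w == [::])%:R.
Definition add_s (f g : series) : series := fun w => f w + g w.
Definition opp_s (f : series) : series := fun w => - f w.
Definition sub_s (f g : series) : series := fun w => f w - g w.

Definition mul_s (f g : series) : series :=
  fun w => \sum_(i < (size w).+1) f (take i w) * g (drop i w).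

Fixpoint pow_s (f : series) (k : nat) : series :=
  if k is k'.+1 then mul_s f (pow_s f k') else one_s.

(* exponential series, for f with zero constant term (the only case used):
   on a word of length m only the terms k <= m contribute. *)
Definition exp_s (f : series) : series :=
  fun w => \sum_(k < (size w).+1) (pow_s f k w) / (k`!)%:R.

(* sh u v w = number of ways of obtaining w as a shuffle of u and v,
   i.e. the coefficient of u (x) v in the unshuffle coproduct of w. *)
Fixpoint sh (u v w : seq 'I_n) : nat :=
  match w with
  | [::] => ((u == [::]) && (v == [::]))%N
  | c :: w' =>
      ((if u is a :: u' then (a == c) * sh u' v w' else 0) +
       (if v is b :: v' then (b == c) * sh u v' w' else 0))%N
  end.

(* the coproduct Delta : \widehat T(V) -> \widehat T(V) \hat(x) \widehat T(V)
   (the continuous algebra map with V primitive); an element of the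
   completed tensor square is a function of pairs of words. *)
Definition coprod (f : series) : seq 'I_n -> seq 'I_n -> K :=
  fun u v => \sum_(t : (size u + size v).-tuple 'I_n) (sh u v t)%:R * f t.

(* primitive elements = \widehat L(V) *)
Definition primitive (f : series) : Prop :=
  forall u v, coprod f u v = f u * (v == [::])%:R + (u == [::])%:R * f v.

Definition hcomp (l : nat) (f : series) : series :=
  fun w => if size w == l then f w else 0.

Definition in_higher_Lie (f : series) : Prop :=
  (forall l, (1 < l)%N -> primitive (hcomp l f)) /\
  (forall w, (size w <= 1)%N -> f w = 0).

Definition in_comm_closure (x : series) : Prop :=
  forall N : nat, exists s : seq (series * series),
    forall w, (size w < N)%N ->
      x w = \sum_(pq <- s) (mul_s pq.1 pq.2 w - mul_s pq.2 pq.1 w).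

Definition trace_eq (x y : series) : Prop := in_comm_closure (sub_s x y).

End Tensor.

(* Main.v *)
(* Let psi = mul o coprod be the second Adams operation. It acts by 2^k on the
   k-th power of a primitive element and commutes with ad x for x primitive, so
   it preserves the span of commutators; separating the eigenvalues 2^k, the
   equality |exp a| = |exp z| gives |a^k| = |z^k| for every k.
   A primitive b with a exp(b) = exp(b) z is built degree by degree. If
   a exp(b) - exp(b) z starts in degree m >= 2 with leading term u, then u is
   primitive, and comparing lowest terms of |a^(m+1)| = |(exp(b) z exp(-b))^(m+1)|
   gives |u x^m| = 0, where x <> 0 is the linear part of z. This forces u = [x, t]
   in the tensor algebra; polynomials in psi project t onto its primitive part
   without changing [x, t], and b is replaced by b - t. *)
From HB Require Import structures.
Require Import Defs.
From mathcomp Require Import all_boot all_order all_algebra.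
From mathcomp Require Import boolp ring zify.
Set Implicit Arguments. Unset Strict Implicit. Unset Printing Implicit Defensive.
Import Order.TTheory GRing.Theory Num.Theory.
Local Open Scope ring_scope.

(** * Sums over the factorizations of a word *)

(** The lowest term of the difference of [|exp a|] and [|exp(b) z exp(-b)|] is only [|u|], which is
    zero for every Lie element [u] of degree at least 2; this is why the powers must be separated.
    The power [m + 1] makes [x^m] as long as [u], which leaves enough room for an argument on cyclic
    words. Commutation of [psi] with [ad y] is available for primitive [y], so commutators are first
    rewritten as commutators with letters. The cyclic sum [tau] makes this possible: in
    characteristic zero a series without constant term killed by [tau] is a sum of such commutators.
    No basis is changed to turn [x] into a letter; a letter [c0] with nonzero coefficient in [x] is
    enough. The additive correction of [b] avoids the Baker-Campbell-Hausdorff formula, since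
    [exp(b - t)] and [exp(b) - t] differ only in degrees above that of [t]. *)

Section Splits.
Variables (T : Type) (V : nmodType).
Implicit Types (F : seq T -> seq T -> V) (w : seq T).

(** A general two-word [F], rather than a product of two series, lets the same lemmas serve the
    product, the coproduct and [psi]. *)
Definition splits F w : V := \sum_(i < (size w).+1) F (take i w) (drop i w).

Lemma splits_nil F : splits F [::] = F [::] [::].
Proof. by rewrite /splits big_ord_recl big_ord0 addr0. Qed.

Lemma splits_cons F a w :
  splits F (a :: w) = F [::] (a :: w) + splits (fun u => F (a :: u)) w.
Proof. by rewrite /splits big_ord_recl. Qed.

Lemma splits_ends F a w :
  splits F (a :: w) = F [::] (a :: w) + F (a :: w) [::]
    + \sum_(i < size w) F (a :: take i w) (drop i w).
Proof.
rewrite splits_cons /splits big_ord_recr /= take_size drop_size.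
by rewrite -addrA (addrC (F _ [::])).
Qed.

Lemma eq_splits F G w : (forall u v, w = u ++ v -> F u v = G u v) ->
  splits F w = splits G w.
Proof. by move=> eqFG; apply: eq_bigr => i _; apply: eqFG; rewrite cat_take_drop. Qed.

Lemma splitsD F G w :
  splits (fun u v => F u v + G u v) w = splits F w + splits G w.
Proof. exact: big_split. Qed.

Lemma splits_sum I (r : seq I) (P : pred I) (F : I -> seq T -> seq T -> V) w :
  splits (fun u v => \sum_(i <- r | P i) F i u v) w
  = \sum_(i <- r | P i) splits (F i) w.
Proof. exact: exchange_big. Qed.

Lemma splits_exchange (F : seq T -> seq T -> seq T -> seq T -> V) w w' :
  splits (fun u v => splits (F u v) w') w
  = splits (fun u' v' => splits (fun u v => F u v u' v') w) w'.
Proof. exact: exchange_big. Qed.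

Lemma splitsA (F : seq T -> seq T -> seq T -> V) w :
  splits (fun u v => splits (fun u1 u2 => F u1 u2 v) u) w
  = splits (fun u v => splits (F u) v) w.
Proof.
elim: w F => [|a w IH] F; first by rewrite !splits_nil.
rewrite !splits_cons splits_nil -addrA; congr (_ + _).
under eq_splits => u v _ do rewrite splits_cons.
by rewrite splitsD IH.
Qed.

Lemma splits0l (F : seq T -> V) w :
  splits (fun u v => if nilp u then F v else 0) w = F w.
Proof. 
by case: w => [|a w]; rewrite ?splits_nil // splits_cons /= /splits big1 ?addr0.
Qed.

Lemma splits0r (F : seq T -> V) w :
  splits (fun u v => if nilp v then F u else 0) w = F w.
Proof.
elim: w F => [|a w IH] F; first by rewrite splits_nil.
by rewrite splits_cons /= add0r (IH (fun u => F (a :: u))).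
Qed.

End Splits.

Lemma splitsMl (T : Type) (R : pzRingType) (c : R) (F : seq T -> seq T -> R) w :
  splits (fun u v => c * F u v) w = c * splits F w.
Proof. by rewrite /splits mulr_sumr. Qed.

Lemma splitsMr (T : Type) (R : pzRingType) (c : R) (F : seq T -> seq T -> R) w :
  splits (fun u v => F u v * c) w = splits F w * c.
Proof. by rewrite /splits mulr_suml. Qed.

(** * The algebra of non-commutative formal power series *)

Section SeriesRing.
Variables (K : fieldType) (n : nat).
Local Notation ser := (series K n).
Implicit Types f g h : ser.

Lemma serP f g : f =1 g -> f = g.
Proof. by move=> e; apply: (@funext (seq 'I_n) K). Qed.

Lemma mul_sE f g w : mul_s f g w = splits (fun u v => f u * g v) w.
Proof. by []. Qed.

HB.instance Definition _ := gen_eqMixin ser.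
HB.instance Definition _ := gen_choiceMixin ser.

Fact add_sA : associative (@add_s K n).
Proof. by move=> f g h; apply: serP => w; rewrite /add_s addrA. Qed.
Fact add_sC : commutative (@add_s K n).
Proof. by move=> f g; apply: serP => w; rewrite /add_s addrC. Qed.
Fact add_0s : left_id (fun=> 0 : K) (@add_s K n).
Proof. by move=> f; apply: serP => w; rewrite /add_s add0r. Qed.
Fact add_Ns : left_inverse (fun=> 0 : K) (@opp_s K n) (@add_s K n).
Proof. by move=> f; apply: serP => w; rewrite /add_s /opp_s addNr. Qed.

HB.instance Definition _ :=
  GRing.isZmodule.Build ser add_sA add_sC add_0s add_Ns.

Fact mul_sA : associative (@mul_s K n).
Proof.
move=> f g h; apply: serP => w.
transitivity (splits (fun u v => splits (fun u1 u2 => f u * (g u1 * h u2)) v) w).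
  by apply: eq_bigr => i _; rewrite [RHS]splitsMl.
transitivity (splits (fun u v => splits (fun u1 u2 => f u1 * g u2 * h v) u) w).
  by rewrite splitsA; do 2!apply: eq_splits => ? ? _; rewrite mulrA.
by apply: eq_bigr => i _; rewrite splitsMr.
Qed.

Fact mul_1s : left_id (@one_s K n) (@mul_s K n).
Proof.
move=> f; apply: serP => w; rewrite mul_sE -[RHS](splits0l f).
by apply: eq_splits => -[|a u] v _; rewrite /one_s /= (mul1r, mul0r).
Qed.

Fact mul_s1 : right_id (@one_s K n) (@mul_s K n).
Proof.
move=> f; apply: serP => w; rewrite mul_sE -[RHS](splits0r f).
by apply: eq_splits => u [|a v] _; rewrite /one_s /= (mulr1, mulr0).
Qed.

Fact mul_sDl : left_distributive (@mul_s K n) +%R.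
Proof.
move=> f g h; apply: serP => w; rewrite -[RHS]/(mul_s _ _ w + mul_s _ _ w) !mul_sE -splitsD.
by apply: eq_splits => u v _; rewrite -mulrDl.
Qed.

Fact mul_sDr : right_distributive (@mul_s K n) +%R.
Proof.
move=> f g h; apply: serP => w; rewrite -[RHS]/(mul_s _ _ w + mul_s _ _ w) !mul_sE -splitsD.
by apply: eq_splits => u v _; rewrite -mulrDr.
Qed.

HB.instance Definition _ := GRing.Zmodule_isPzRing.Build ser
  mul_sA mul_1s mul_s1 mul_sDl mul_sDr.

Fact one_s_neq0 : (1 : ser) != 0.
Proof.
apply/eqP => /(congr1 (fun f : ser => f [::])) /eqP.
by rewrite -[(1 : ser) _]/(1 : K) oner_eq0.
Qed.

HB.instance Definition _ := GRing.PzSemiRing_isNonZero.Build ser one_s_neq0.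

Definition scale_s (c : K) (f : ser) : ser := fun w => c * f w.

Fact scale_sA a b f : scale_s a (scale_s b f) = scale_s (a * b) f.
Proof. by apply: serP => w; rewrite /scale_s mulrA. Qed.
Fact scale_1s : left_id 1 scale_s.
Proof. by move=> f; apply: serP => w; rewrite /scale_s mul1r. Qed.
Fact scale_sDr : right_distributive scale_s +%R.
Proof. by move=> a f g; apply: serP => w; rewrite /scale_s mulrDr. Qed.
Fact scale_sDl f : {morph scale_s^~ f : a b / a + b}.
Proof. by move=> a b; apply: serP => w; rewrite /scale_s mulrDl. Qed.

HB.instance Definition _ := GRing.Zmodule_isLmodule.Build K ser
  scale_sA scale_1s scale_sDr scale_sDl.

Fact scale_sAl a f g : a *: (f * g) = (a *: f) * g.
Proof.
apply: serP => w; rewrite -[LHS]/(a * mul_s f g w) -[RHS]/(mul_s _ _ w) !mul_sE.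
by rewrite -splitsMl; apply: eq_splits => u v _; rewrite mulrA.
Qed.

HB.instance Definition _ := GRing.Lmodule_isLalgebra.Build K ser scale_sAl.

Fact scale_sAr a f g : a *: (f * g) = f * (a *: g).
Proof.
apply: serP => w; rewrite -[LHS]/(a * mul_s f g w) -[RHS]/(mul_s _ _ w) !mul_sE.
by rewrite -splitsMl; apply: eq_splits => u v _; rewrite mulrCA.
Qed.

HB.instance Definition _ := GRing.Lalgebra_isAlgebra.Build K ser scale_sAr.

Lemma serD f g w : (f + g) w = f w + g w. Proof. by []. Qed.
Lemma serN f w : (- f) w = - f w. Proof. by []. Qed.
Lemma serB f g w : (f - g) w = f w - g w. Proof. by []. Qed.
Lemma ser0 w : (0 : ser) w = 0. Proof. by []. Qed.
Lemma ser1 w : (1 : ser) w = (w == [::])%:R. Proof. by []. Qed.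
Lemma serZ c f w : (c *: f) w = c * f w. Proof. by []. Qed.
Lemma serM f g w : (f * g) w = splits (fun u v => f u * g v) w. Proof. by []. Qed.
Lemma serM0 f g : (f * g) [::] = f [::] * g [::].
Proof. by rewrite serM splits_nil. Qed.
Lemma ser_sum I (r : seq I) (P : pred I) (F : I -> ser) w :
  (\sum_(i <- r | P i) F i) w = \sum_(i <- r | P i) F i w.
Proof. exact: (big_morph (fun f : ser => f w)). Qed.

Lemma pow_sE f k : pow_s f k = f ^+ k.
Proof. by elim: k => //= k ->; rewrite exprS. Qed.

End SeriesRing.

(** * Shuffle coproduct *)

Section Coproduct.
Variables (K : fieldType) (n : nat).
Local Notation ser := (series K n).
Local Notation word := (seq 'I_n).
Implicit Types (f g h : ser) (u v w : word).

Definition lder (a : 'I_n) f : ser := fun w => f (a :: w).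

(* [coprod] with the length of the shuffled word decoupled from [u] and [v],
   so that the recursion on its first letter can be stated. *)
Definition coprod_at m f u v : K := \sum_(t : m.-tuple 'I_n) (sh u v t)%:R * f t.

Lemma coprod_at0 f u v :
  coprod_at 0 f u v = (nilp u && nilp v)%:R * f [::].
Proof.
rewrite /coprod_at (bigD1 [tuple]) //= big1 ?addr0; last first.
  by move=> t; rewrite [t]tuple0.
by rewrite -!size_eq0 /nilp.
Qed.

Lemma coprod_atS m f u v : coprod_at m.+1 f u v =
  (if u is a :: u' then coprod_at m (lder a f) u' v else 0)
  + (if v is b :: v' then coprod_at m (lder b f) u v' else 0).
Proof.
have pick a (F : 'I_n -> K) : \sum_c (a == c)%:R * F c = F a.
  rewrite (bigD1 a) //= eqxx mul1r big1 ?addr0 // => c; rewrite eq_sym => /negPf ->.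
  by rewrite mul0r.
pose cons2 (p : 'I_n * m.-tuple 'I_n) := [tuple of p.1 :: p.2].
rewrite /coprod_at (reindex cons2) /=; last first.
  exists (fun t => (thead t, [tuple of behead t])) => [[c t] _|t _] /=.
    by congr (_, _); apply: val_inj.
  by rewrite /cons2 /= -tuple_eta.
rewrite -(pair_bigA _ (fun c t => (sh u v (c :: tval t))%:R * f (c :: tval t))) /=.
under eq_bigr => c _ do (under eq_bigr => t _ do rewrite natrD mulrDl);
  under eq_bigr => c _ do rewrite big_split /=.
rewrite big_split /=; congr (_ + _).
  case: u => [|a u]; first by rewrite big1 // => c _; rewrite big1 // => t _; rewrite mul0r.
  rewrite -(pick a (fun c => \sum_(t : m.-tuple 'I_n) (sh u v t)%:R * f (c :: t))).
  by apply: eq_bigr => c _; rewrite mulr_sumr; apply: eq_bigr => t _; rewrite natrM mulrA.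
case: v => [|b v]; first by rewrite big1 // => c _; rewrite big1 // => t _; rewrite mul0r.
rewrite -(pick b (fun c => \sum_(t : m.-tuple 'I_n) (sh u v t)%:R * f (c :: t))).
by apply: eq_bigr => c _; rewrite mulr_sumr; apply: eq_bigr => t _; rewrite natrM mulrA.
Qed.

Lemma coprodE f u v : coprod f u v = coprod_at (size u + size v) f u v.
Proof. by []. Qed.

(** With [f] read as a linear form on words, [coprod f u v] is its value on the shuffle product of
    [u] and [v]. This lemma and [coprod_nilr], [coprodC], [coprodA] are the unit, commutativity and
    associativity of shuffling. *)
Lemma coprod_nill f v : coprod f [::] v = f v.
Proof.
elim: v f => [|b v IH] f; first by rewrite coprodE coprod_at0 mul1r.
by rewrite coprodE add0n coprod_atS add0r [LHS]IH.
Qed.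

Lemma coprod_nilr f u : coprod f u [::] = f u.
Proof.
elim: u f => [|a u IH] f; first by rewrite coprodE coprod_at0 mul1r.
by rewrite coprodE addSn coprod_atS addr0 [LHS]IH.
Qed.

Lemma coprod_cons f a b u v : coprod f (a :: u) (b :: v) =
  coprod (lder a f) u (b :: v) + coprod (lder b f) (a :: u) v.
Proof. by rewrite coprodE addSn coprod_atS !coprodE /= addnS. Qed.

Lemma eq_coprod_size f g u v :
  (forall w, size w = (size u + size v)%N -> f w = g w) ->
  coprod f u v = coprod g u v.
Proof. by move=> efg; apply: eq_bigr => t _; rewrite efg ?size_tuple. Qed.

Lemma eq_coprod f g u v : f =1 g -> coprod f u v = coprod g u v.
Proof. by move=> e; apply: eq_coprod_size. Qed.

Lemma coprodD f g u v : coprod (f + g) u v = coprod f u v + coprod g u v.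
Proof. by rewrite -big_split; apply: eq_bigr => t _; rewrite serD mulrDr. Qed.

Lemma coprodZ c f u v : coprod (c *: f) u v = c * coprod f u v.
Proof. by rewrite mulr_sumr; apply: eq_bigr => t _; rewrite serZ mulrCA. Qed.

Lemma coprodB f g u v : coprod (f - g) u v = coprod f u v - coprod g u v.
Proof. by rewrite -scaleN1r coprodD coprodZ mulN1r. Qed.

Lemma coprod0 u v : coprod (0 : ser) u v = 0.
Proof. by rewrite -(scale0r (0 : ser)) coprodZ mul0r. Qed.

Lemma coprod_sum I (r : seq I) (P : pred I) (F : I -> ser) u v :
  coprod (\sum_(i <- r | P i) F i) u v = \sum_(i <- r | P i) coprod (F i) u v.
Proof.
apply: (big_morph (fun f => coprod f u v)) => [f g|]; first exact: coprodD.
exact: coprod0.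
Qed.

Lemma coprodC f u v : coprod f u v = coprod f v u.
Proof.
elim: u v f => [|a u IHu] v f; first by rewrite coprod_nill coprod_nilr.
elim: v f => [|b v IHv] f; first by rewrite coprod_nill coprod_nilr.
by rewrite !coprod_cons addrC IHv IHu.
Qed.

Lemma coprodA f u v s :
  coprod (fun w => coprod f w s) u v = coprod (coprod f u) v s.
Proof.
elim: u v s f => [|a u IHu] v s f.
  by rewrite coprod_nill; apply: eq_coprod => w; rewrite coprod_nill.
elim: v s f => [|b v IHv] s f; first by rewrite coprod_nill coprod_nilr.
elim: s f => [|c s IHs] f.
  by rewrite coprod_nilr; apply: eq_coprod => w; rewrite coprod_nilr.
rewrite !coprod_cons.
rewrite (@eq_coprod (lder a _) (fun w => coprod (lder a f) w (c :: s)
                                 + coprod (lder c f) (a :: w) s)); last first.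
  by move=> w; rewrite /lder coprod_cons.
rewrite (@eq_coprod (lder b _) (fun w => coprod (lder b f) w (c :: s)
                                 + coprod (lder c f) (b :: w) s)); last first.
  by move=> w; rewrite /lder coprod_cons.
rewrite [in RHS](@eq_coprod (lder b _) (fun w => coprod (lder a f) u (b :: w)
                                 + coprod (lder b f) (a :: u) w)); last first.
  by move=> w; rewrite /lder coprod_cons.
rewrite [in RHS](@eq_coprod (lder c _) (fun w => coprod (lder a f) u (c :: w)
                                 + coprod (lder c f) (a :: u) w)); last first.
  by move=> w; rewrite /lder coprod_cons.
have D (F G : ser) x y : coprod (fun w => F w + G w) x y = coprod F x y + coprod G x y.
  exact: coprodD.
rewrite !D IHu IHv -IHs !coprod_cons -!/(lder _ _).
rewrite -addrA [X in _ + X]addrCA addrACA.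
by [].
Qed.

(** Cutting a shuffle of [u] and [v] amounts to cutting both words and shuffling the pieces. An
    arbitrary [F] covers [psi f] as well as [f * g]. *)
Lemma coprod_splits (F : word -> word -> K) u v :
  coprod (splits F) u v = splits (fun u1 u2 => splits (fun v1 v2 =>
    coprod (fun w => coprod (F w) u2 v2) u1 v1) v) u.
Proof.
have D (f g : ser) x y : coprod (fun w => f w + g w) x y = coprod f x y + coprod g x y.
  exact: coprodD.
have lderS a (F' : word -> word -> K) w :
    lder a (splits F') w = F' [::] (a :: w) + splits (fun x => F' (a :: x)) w.
  by rewrite /lder splits_cons.
elim: u v F => [|a u IHu] v F.
  rewrite splits_nil coprod_nill; apply: eq_splits => v1 v2 _.
  by rewrite !coprod_nill.
elim: v F => [|b v IHv] F.
  rewrite coprod_nilr; apply: eq_splits => u1 u2 _.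
  by rewrite splits_nil !coprod_nilr.
rewrite coprod_cons !(eq_coprod _ _ (lderS _ F)) !D IHu IHv.
rewrite addrACA -[_ + coprod _ (a :: u) v](coprod_cons (F [::])).
rewrite [in RHS]splits_cons [X in _ = X + _]splits_cons !coprod_nill.
rewrite -addrA; congr (_ + _).
rewrite addrC [in LHS]splits_cons -addrA; congr (_ + _).
  by apply: eq_splits => v1 v2 _; rewrite !coprod_nill; apply: eq_coprod.
rewrite -splitsD; apply: eq_splits => u1 u2 _.
rewrite !splits_cons !coprod_nilr addrC -addrA; congr (_ + _).
rewrite -splitsD; apply: eq_splits => v1 v2 _.
by rewrite coprod_cons.
Qed.

Lemma coprodM f g u v : coprod (f * g) u v = splits (fun u1 u2 =>
  splits (fun v1 v2 => coprod f u1 v1 * coprod g u2 v2) v) u.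
Proof.
rewrite (eq_coprod _ _ (serM f g)) (coprod_splits (fun x y => f x * g y)).
do 2!apply: eq_splits => ? ? _.
rewrite mulrC -coprodZ; apply: eq_coprod => w.
by rewrite serZ mulrC -coprodZ; apply: eq_coprod.
Qed.

(* The second Adams operation: the product after the coproduct. *)
Definition psi f : ser := splits (coprod f).

Lemma psiD f g : psi (f + g) = psi f + psi g.
Proof.
apply: serP => w; rewrite serD -splitsD.
by apply: eq_splits => u v _; rewrite coprodD.
Qed.

Lemma psiZ c f : psi (c *: f) = c *: psi f.
Proof.
apply: serP => w; rewrite serZ -splitsMl.
by apply: eq_splits => u v _; rewrite coprodZ.
Qed.

Lemma psiB f g : psi (f - g) = psi f - psi g.
Proof. by rewrite -scaleN1r psiD psiZ scaleN1r. Qed.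

Lemma psi_sum I (r : seq I) (P : pred I) (F : I -> ser) :
  psi (\sum_(i <- r | P i) F i) = \sum_(i <- r | P i) psi (F i).
Proof.
apply: (big_morph psi); first exact: psiD.
by rewrite -(scale0r 0) psiZ !scale0r.
Qed.

Lemma eq_psi_size f g w : (forall w', size w' = size w -> f w' = g w') ->
  psi f w = psi g w.
Proof.
move=> e; apply: eq_splits => u v uv; apply: eq_coprod_size => w' sw'.
by rewrite e // sw' uv size_cat.
Qed.

Lemma eq_psi f g : f =1 g -> psi f = psi g.
Proof. by move=> e; apply: serP => w; apply: eq_psi_size. Qed.

(* Dually: [psi] is multiplicative for the shuffle product. *)
Lemma coprod_psi f u v : coprod (psi f) u v =
  splits (fun u1 u2 => psi (coprod (coprod f u1) u2) v) u.
Proof.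
rewrite coprod_splits; apply: eq_splits => u1 u2 _; apply: eq_splits => v1 v2 _.
rewrite (eq_coprod (g := fun w => coprod (fun w' => coprod f w' v2) w u2)); last first.
  by move=> w; rewrite coprodA.
rewrite coprodA coprodC -[RHS]coprodA; apply: eq_coprod => w.
by rewrite coprodA.
Qed.

End Coproduct.

(** * Primitive elements and the Adams operation *)

Section Primitive.
Variables (K : fieldType) (n : nat).
Local Notation ser := (series K n).
Local Notation word := (seq 'I_n).
Implicit Types (a b f g h x : ser) (u v w : word).

Lemma primitive0 f : primitive f -> f [::] = 0.
Proof.
move=> /(_ [::] [::]); rewrite coprod_nill eqxx mulr1 mul1r => /eqP.
by rewrite -subr_eq0 opprD addNKr oppr_eq0 => /eqP.
Qed.

Lemma primitiveP f : f [::] = 0 ->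
  (forall u v, u != [::] -> v != [::] -> coprod f u v = 0) -> primitive f.
Proof.
move=> f0 fP u v; case: (altP (u =P [::])) => [->|u0].
  rewrite coprod_nill mul1r; case: eqP => [->|_]; first by rewrite f0 mul0r addr0.
  by rewrite mulr0 add0r.
case: (altP (v =P [::])) => [->|v0]; first by rewrite coprod_nilr mulr1 mul0r addr0.
by rewrite fP // mulr0 mul0r addr0.
Qed.

Lemma primitive_0 : primitive (0 : ser).
Proof. by move=> u v; rewrite coprod0 !ser0 mul0r mulr0 addr0. Qed.

Lemma primitiveD f g : primitive f -> primitive g -> primitive (f + g).
Proof.
by move=> fP gP u v; rewrite coprodD fP gP !serD mulrDl mulrDr addrACA.
Qed.

Lemma primitiveN f : primitive f -> primitive (- f).
Proof.
move=> fP u v; rewrite -scaleN1r coprodZ fP !serZ !mulN1r.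
by rewrite mulNr mulrN opprD.
Qed.

Lemma coprod_hcomp m f u v :
  coprod (hcomp m f) u v = if (size u + size v == m)%N then coprod f u v else 0.
Proof.
case: eqP => [<-|uv].
  by apply: eq_coprod_size => w sw; rewrite /hcomp sw eqxx.
rewrite -[RHS](mul0r (coprod f u v)) -coprodZ; apply: eq_coprod_size => w sw.
by rewrite /hcomp serZ mul0r sw; case: eqP.
Qed.

Lemma primitive_hcomp m f : primitive f -> primitive (hcomp m f).
Proof.
move=> fP; apply: primitiveP => [|u v u0 v0].
  by rewrite /hcomp primitive0 // if_same.
by rewrite coprod_hcomp fP (negPf u0) (negPf v0) mulr0 mul0r addr0 if_same.
Qed.

(** The coproduct of [x] is x (x) 1 + 1 (x) x, and it multiplies that of [f]: the letters of [x] are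
    taken from the left of [u] or from the left of [v]. *)
Lemma coprod_primMl x f u v : primitive x -> coprod (x * f) u v =
  splits (fun u1 u2 => x u1 * coprod f u2 v) u
  + splits (fun v1 v2 => x v1 * coprod f u v2) v.
Proof.
move=> xP; rewrite coprodM.
transitivity (splits (fun u1 u2 =>
   splits (fun v1 v2 => if nilp v1 then x u1 * coprod f u2 v2 else 0) v
   + splits (fun v1 v2 => if nilp u1 then x v1 * coprod f u2 v2 else 0) v) u).
  apply: eq_splits => u1 u2 _; rewrite -splitsD; apply: eq_splits => v1 v2 _.
  rewrite xP mulrDl -!nilpE; do 2!case: nilp;
  by rewrite !(mulr1, mul1r, mulr0, mul0r, addr0, add0r).
rewrite splitsD; congr (_ + _).
  by apply: eq_splits => u1 u2 _; rewrite splits0l.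
by rewrite splits_exchange; apply: eq_splits => v1 v2 _; rewrite splits0l.
Qed.

Lemma coprod_primMr x f u v : primitive x -> coprod (f * x) u v =
  splits (fun u1 u2 => coprod f u1 v * x u2) u
  + splits (fun v1 v2 => coprod f u v1 * x v2) v.
Proof.
move=> xP; rewrite coprodM.
transitivity (splits (fun u1 u2 =>
   splits (fun v1 v2 => if nilp v2 then coprod f u1 v1 * x u2 else 0) v
   + splits (fun v1 v2 => if nilp u2 then coprod f u1 v1 * x v2 else 0) v) u).
  apply: eq_splits => u1 u2 _; rewrite -splitsD; apply: eq_splits => v1 v2 _.
  rewrite xP mulrDr -!nilpE; do 2!case: nilp;
  by rewrite !(mulr1, mul1r, mulr0, mul0r, addr0, add0r).
rewrite splitsD; congr (_ + _).
  by apply: eq_splits => u1 u2 _; rewrite (splits0r (fun v1 => coprod f u1 v1 * x u2)).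
rewrite splits_exchange; apply: eq_splits => v1 v2 _.
by rewrite (splits0r (fun u1 => coprod f u1 v1 * x v2)).
Qed.

(* Cutting a word in three pieces [u], [s], [v], the terms [f(u, v) x(s)] occur
   in both [psi (x * f)] and [psi (f * x)], and cancel. *)
Lemma psi_ad x f : primitive x ->
  psi (x * f - f * x) = x * psi f - psi f * x.
Proof.
move=> xP; apply: serP => w; rewrite psiB !serB.
pose mid := splits (fun u s => splits (fun s1 s2 => coprod f u s2 * x s1) s) w.
have -> : psi (x * f) w = (x * psi f) w + mid.
  rewrite /psi; under eq_splits => u v _ do rewrite coprod_primMl //.
  rewrite splitsD (splitsA (fun u1 u2 v => x u1 * coprod f u2 v)); congr (_ + _).
    by rewrite serM; apply: eq_splits => u v _; rewrite splitsMl.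
  by do 2!apply: eq_splits => ? ? _; rewrite mulrC.
have -> : psi (f * x) w = mid + (psi f * x) w.
  rewrite /psi; under eq_splits => u v _ do rewrite coprod_primMr //.
  rewrite splitsD (splitsA (fun u1 u2 v => coprod f u1 v * x u2)); congr (_ + _).
  rewrite -(splitsA (fun u v1 v2 => coprod f u v1 * x v2)).
  by rewrite serM; apply: eq_splits => u v _; rewrite splitsMr.
by rewrite opprD addrA addrK.
Qed.

Lemma psi_prim f : primitive f -> psi f = f + f.
Proof.
move=> fP; apply: serP => w; rewrite serD /psi.
rewrite -[X in X + _](splits0r f) -[X in _ + X](splits0l f) -splitsD.
apply: eq_splits => u v _; rewrite fP -!nilpE.
by do 2!case: nilp; rewrite !(mulr1, mul1r, mulr0, mul0r, addr0).
Qed.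

End Primitive.

(** * Divided powers of primitive elements *)

Section Exponential.
Variables (K : fieldType) (n : nat).
Hypothesis charK : [pchar K] =i pred0.
Local Notation ser := (series K n).
Local Notation word := (seq 'I_n).
Implicit Types (a b f g h x : ser) (u v w : word).

Lemma natrS_neq0 k : k.+1%:R != 0 :> K.
Proof. by have /pcharf0P -> := charK. Qed.

Lemma fact_neq0 k : k`!%:R != 0 :> K.
Proof. by have /pcharf0P -> := charK; rewrite -lt0n fact_gt0. Qed.

Lemma natr_inj : injective (fun k => k%:R : K).
Proof.
have /pcharf0P char0 := charK; move=> i j /=.
wlog ij : i j / (i <= j)%N => [IH e|e].
  by case/orP: (leq_total i j) => ij; [exact: IH | apply/esym/IH].
by apply/eqP; rewrite eqn_leq ij -subn_eq0 -char0 natrB // e subrr eqxx.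
Qed.

Lemma triangle_sum (V : nmodType) N (F : nat -> nat -> V) :
  (forall i j, (N <= i + j)%N -> F i j = 0) ->
  \sum_(k < N) \sum_(i < k.+1) F i (k - i)%N = \sum_(i < N) \sum_(j < N) F i j.
Proof.
move=> F0.
transitivity (\sum_(k < N) \sum_(i < N | (i <= k)%N) F i (k - i)%N).
  apply: eq_bigr => k _.
  by rewrite (big_ord_widen N (fun i => F i (k - i)%N)) ?ltn_ord.
rewrite (exchange_big_dep xpredT) //=; apply: eq_bigr => i _.
rewrite -(big_mkord (fun k => i <= k)%N (fun k => F i (k - i)%N)).
rewrite -(big_mkord xpredT (fun j => F i j)).
rewrite (@big_cat_nat _ _ _ i) //= ?(ltnW (ltn_ord i)) //.
rewrite big_nat_cond big1 ?add0r; last first.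
  by move=> k /andP [/andP [_ ki]]; rewrite leqNgt ki.
rewrite (@big_cat_nat _ _ _ (N - i)%N 0) //= ?leq_subr //.
rewrite [X in _ = _ + X]big_nat_cond [X in _ = _ + X]big1 ?addr0; last first.
  by move=> k /andP [/andP [ki _] _]; apply: F0; rewrite -leq_subLR.
rewrite -{1}(add0n (i : nat)) big_addn; apply: congr_big_nat => // k.
  by rewrite leq_addl.
by rewrite addnK.
Qed.

Definition epow k a : ser := k`!%:R^-1 *: a ^+ k.

Lemma epowS k a : k.+1%:R *: epow k.+1 a = a * epow k a.
Proof.
rewrite /epow scalerA exprS scalerAr factS natrM invfM mulrA.
by rewrite divff ?natrS_neq0 // mul1r.
Qed.

(** The binomial expansion of the [k]-th power of a (x) 1 + 1 (x) a; divided powers absorb the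
    binomial coefficients. In the induction the two summands of the coproduct of [a] contribute the
    weights [i] and [k.+1 - i], whose sum is the factor [k.+1] of [epowS]. *)
Lemma epow_coprod k a u v : primitive a ->
  coprod (epow k a) u v = \sum_(i < k.+1) epow i a u * epow (k - i) a v.
Proof.
move=> aP; elim: k u v => [|k IH] u v.
  rewrite big_ord1 subn0 /epow fact0 invr1 !scale1r expr0.
  elim: u v => [|c u IHu] v; first by rewrite coprod_nill mul1r.
  case: v => [|d v]; first by rewrite coprod_nilr mulr1.
  rewrite !ser1 mul0r coprod_cons -[lder c 1]/(fun=> 0 : K) -[lder d 1]/(fun=> 0 : K).
  by rewrite /coprod !big1 ?addr0 // => t _; rewrite mulr0.
apply: (mulfI (natrS_neq0 k)); rewrite -coprodZ epowS coprod_primMl //.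
under eq_splits => u1 u2 _ do rewrite IH mulr_sumr.
under [X in _ + X]eq_splits => u1 u2 _ do rewrite IH mulr_sumr.
rewrite !splits_sum.
transitivity (\sum_(i < k.+2) i%:R * (epow i a u * epow (k.+1 - i) a v)
   + \sum_(i < k.+2) (k.+1 - i)%:R * (epow i a u * epow (k.+1 - i) a v)).
  congr (_ + _).
    rewrite [RHS]big_ord_recl mul0r add0r; apply: eq_bigr => i _.
    rewrite lift0 subSS mulrA -(serZ i.+1%:R) epowS serM -splitsMr.
    by apply: eq_splits => u1 u2 _; rewrite mulrA.
  rewrite [RHS]big_ord_recr /= subnn mul0r addr0; apply: eq_bigr => i _.
  rewrite subSn ?leq_ord // mulrCA -(serZ (k - i).+1%:R) epowS serM -splitsMl.
  by apply: eq_splits => u1 u2 _; rewrite mulrCA.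
rewrite -big_split mulr_sumr; apply: eq_bigr => i _ /=.
by rewrite -mulrDl -natrD subnKC ?leq_ord.
Qed.

Lemma epowD_comm k a b : GRing.comm a b ->
  \sum_(i < k.+1) epow i a * epow (k - i) b = epow k (a + b).
Proof.
move=> ab; rewrite /epow addrC exprDn_comm; last exact/commr_sym.
rewrite scaler_sumr; apply: eq_bigr => i _.
rewrite -scalerAl -scalerAr scalerA -scaler_nat scalerA; congr (_ *: _).
  have le_ik : (i <= k)%N by rewrite -ltnS.
  rewrite -(bin_fact le_ik) !natrM !invfM.
  have := fact_neq0 i; have := fact_neq0 (k - i).
  have : 'C(k, i)%:R != 0 :> K.
    by have /pcharf0P -> := charK; rewrite -lt0n bin_gt0.
  move: ('C(k, i)%:R) (i`!%:R) ((k - i)`!%:R) => p q r p0 q0 r0.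
  by field; rewrite p0 q0 r0.
by apply: commrX; apply: commr_sym; apply: commrX.
Qed.

Lemma epowZ k c a : epow k (c *: a) = c ^+ k *: epow k a.
Proof. by rewrite /epow exprZn scalerA mulrC -scalerA. Qed.

(** Multiplying out the coproduct gives the divided power of [a + a]. *)
Lemma psi_epow k a : primitive a -> psi (epow k a) = (2 ^+ k) *: epow k a.
Proof.
move=> aP; rewrite -epowZ scaler_nat mulr2n -epowD_comm //.
apply: serP => w; rewrite /psi ser_sum.
by under eq_splits => u v _ do rewrite epow_coprod //; rewrite splits_sum.
Qed.

End Exponential.

(** * Order filtration and exponential *)

Section Order.
Variables (K : fieldType) (n : nat).
Local Notation ser := (series K n).
Local Notation word := (seq 'I_n).
Implicit Types (a b f g h x : ser) (u v w : word).

Definition ord m f := forall w, (size w < m)%N -> f w = 0.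

Definition homogeneous m f := forall w, size w != m -> f w = 0.

Lemma ordW m p f : (p <= m)%N -> ord m f -> ord p f.
Proof. by move=> pm fm w wp; apply: fm; apply: leq_trans pm. Qed.

Lemma ord_zero f : ord 0 f. Proof. by []. Qed.

Lemma ordD m f g : ord m f -> ord m g -> ord m (f + g).
Proof. by move=> fm gm w wm; rewrite serD fm ?gm ?addr0. Qed.

Lemma ordN m f : ord m f -> ord m (- f).
Proof. by move=> fm w wm; rewrite serN fm ?oppr0. Qed.

Lemma ordB m f g : ord m f -> ord m g -> ord m (f - g).
Proof. by move=> fm gm; apply: ordD => //; apply: ordN. Qed.

Lemma ordZ m c f : ord m f -> ord m (c *: f).
Proof. by move=> fm w wm; rewrite serZ fm ?mulr0. Qed.

Lemma ordM p q f g : ord p f -> ord q g -> ord (p + q)%N (f * g).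
Proof.
move=> fp gq w wpq; rewrite serM /splits big1 // => i _.
case: (ltnP i p) => ip.
  rewrite fp ?mul0r // size_take_min; exact: leq_ltn_trans (geq_minl _ _) ip.
rewrite gq ?mulr0 // size_drop ltn_subLR; last by rewrite -ltnS ltn_ord.
by apply: leq_trans wpq _; rewrite leq_add2r.
Qed.

Lemma ordX k f : ord 1 f -> ord k (f ^+ k).
Proof. by move=> f1; elim: k => [|k IH] //; rewrite exprS; apply: (ordM f1). Qed.

Lemma ord1P f : f [::] = 0 -> ord 1 f.
Proof. by move=> f0 [|c w]. Qed.

Lemma primitive_ord1 f : primitive f -> ord 1 f.
Proof. by move=> fP; apply: ord1P; apply: primitive0. Qed.

Lemma hom_ord m f : homogeneous m f -> ord m f.
Proof. by move=> fm w wm; apply: fm; rewrite ltn_eqF. Qed.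

Lemma hom_hcomp m f : homogeneous m (hcomp m f).
Proof. by move=> w /negPf wm; rewrite /hcomp wm. Qed.

Lemma ord_hcomp m f : ord m f -> ord m.+1 (f - hcomp m f).
Proof.
move=> fm w; rewrite ltnS leq_eqVlt serB /hcomp => /orP [/eqP wm|wm].
  by rewrite wm eqxx subrr.
by rewrite fm // ltn_eqF // subr0.
Qed.

Lemma mul_homl p f g w : homogeneous p f -> (p <= size w)%N ->
  (f * g) w = f (take p w) * g (drop p w).
Proof.
move=> fp pw; rewrite serM /splits (bigD1 (inord p)) //= inordK //.
rewrite big1 ?addr0 // => i; rewrite -val_eqE /= inordK // => ip.
by rewrite fp ?mul0r // size_takel // -ltnS.
Qed.

Lemma mul_homr q f g w : homogeneous q g -> (q <= size w)%N ->
  (f * g) w = f (take (size w - q) w) * g (drop (size w - q) w).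
Proof.
move=> gq qw; have lt_wq : (size w - q < (size w).+1)%N by rewrite ltnS leq_subr.
rewrite serM /splits (bigD1 (inord (size w - q))) //= inordK //.
rewrite big1 ?addr0 // => i; rewrite -val_eqE /= inordK // => ip.
rewrite gq ?mulr0 // size_drop; apply: contra ip => /eqP <-.
by rewrite subKn // -ltnS.
Qed.

Lemma homM p q f g : homogeneous p f -> homogeneous q g -> homogeneous (p + q)%N (f * g).
Proof.
move=> fp gq w wpq; case: (leqP p (size w)) => pw.
  rewrite (mul_homl _ fp) // gq ?mulr0 // size_drop.
  by apply: contra wpq => /eqP <-; rewrite subnKC.
by apply: (ordM (hom_ord fp) (@ord_zero g)); rewrite addn0.
Qed.

Lemma homX k x : homogeneous 1 x -> homogeneous k (x ^+ k).
Proof.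
move=> x1; elim: k => [[|c w] //|k IH].
by rewrite exprS -add1n; apply: homM.
Qed.

Lemma hom1_mull x f c w : homogeneous 1 x -> (x * f) (c :: w) = x [:: c] * f w.
Proof. by move=> x1; rewrite (mul_homl _ x1) //= take0 drop0. Qed.

Lemma hom1_mulr x f c w : homogeneous 1 x -> (f * x) (rcons w c) = f w * x [:: c].
Proof.
move=> x1; rewrite (mul_homr _ x1) size_rcons // subn1 /= -cats1.
by rewrite take_size_cat ?drop_size_cat.
Qed.

Lemma hom1_nil x : homogeneous 1 x -> x [::] = 0.
Proof. by apply. Qed.

End Order.

(** * The exponential series and its group-like property *)

Section Exponential.
Variables (K : fieldType) (n : nat).
Hypothesis charK : [pchar K] =i pred0.
Local Notation ser := (series K n).
Local Notation word := (seq 'I_n).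
Implicit Types (a b f g h x : ser) (u v w : word).

Lemma ord_epow k f : ord 1 f -> ord k (epow k f).
Proof. by move=> f1; apply/ordZ/ordX. Qed.

Lemma exp_sE f w : exp_s f w = \sum_(k < (size w).+1) epow k f w.
Proof. by apply: eq_bigr => k _; rewrite pow_sE /epow serZ mulrC. Qed.

(** [N] is free so that one truncation can serve all factors of a word at once. *)
Lemma exp_s_trunc N f w : ord 1 f -> (size w < N)%N ->
  exp_s f w = \sum_(k < N) epow k f w.
Proof.
move=> f1 wN; rewrite exp_sE (big_ord_widen N (fun k => epow k f w)) //.
rewrite big_mkcond; apply: eq_bigr => k _; case: ifPn => // kw.
by rewrite (ord_epow f1) // ltnNge -ltnS.
Qed.

Lemma exp_s0 f : exp_s f [::] = 1.
Proof. by rewrite exp_sE big_ord1 /epow fact0 invr1 scale1r. Qed.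

Lemma exp_s0E : exp_s (0 : ser) = 1.
Proof.
apply: serP => w; rewrite exp_sE big_ord_recl big1 => [|k _].
  by rewrite /epow fact0 invr1 scale1r expr0 addr0.
by rewrite /epow lift0 expr0n scaler0.
Qed.

Lemma exp_coprod b u v : primitive b ->
  coprod (exp_s b) u v = exp_s b u * exp_s b v.
Proof.
move=> bP; have b1 := primitive_ord1 bP; pose N := (size u + size v).+1.
rewrite (@eq_coprod_size _ _ _ (\sum_(k < N) epow k b)); last first.
  by move=> w wN; rewrite ser_sum (exp_s_trunc b1 (N := N)) // wN.
rewrite coprod_sum; under eq_bigr => k _ do rewrite epow_coprod //.
rewrite (triangle_sum (F := fun i j => epow i b u * epow j b v)); last first.
  move=> i j; case: (ltnP (size u) i) => ui ij.
    by rewrite (ord_epow b1) ?mul0r.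
  rewrite (ord_epow b1 (w := v)) ?mulr0 //.
  by rewrite -(ltn_add2l i); apply: leq_trans ij; rewrite ltnS leq_add2r.
rewrite (@exp_s_trunc N _ u) ?(@exp_s_trunc N _ v) //.
- by rewrite mulr_suml; apply: eq_bigr => i _; rewrite mulr_sumr.
- by rewrite ltnS leq_addl.
by rewrite ltnS leq_addr.
Qed.

Lemma exp_sN b : ord 1 b -> exp_s b * exp_s (- b) = 1.
Proof.
move=> b1; apply: serP => w; pose N := (size w).+1; have Nb1 := ordN b1.
transitivity (\sum_(i < N) \sum_(j < N) (epow i b * epow j (- b)) w).
  under [RHS]eq_bigr => i _ do under eq_bigr => j _ do rewrite serM.
  under [RHS]eq_bigr => i _ do rewrite -splits_sum.
  rewrite -splits_sum serM; apply: eq_splits => u v uv.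
  rewrite (@exp_s_trunc N _ u) ?(@exp_s_trunc N _ v) //.
  - by rewrite mulr_suml; apply: eq_bigr => i _; rewrite mulr_sumr.
  - by rewrite /N uv size_cat ltnS leq_addl.
  by rewrite /N uv size_cat ltnS leq_addr.
rewrite -(triangle_sum (F := fun i j => (epow i b * epow j (- b)) w)); last first.
  by move=> i j Nij; apply: (ordM (ord_epow b1) (ord_epow Nb1)).
transitivity (\sum_(k < N) epow k (b - b) w).
  apply: eq_bigr => k _; rewrite -epowD_comm ?ser_sum //.
  by rewrite /GRing.comm mulrN mulNr.
rewrite subrr big_ord_recl big1 => [|k _].
  by rewrite /epow fact0 invr1 scale1r expr0 addr0.
by rewrite /epow lift0 expr0n scaler0.
Qed.

Lemma exp_sNK b : ord 1 b -> exp_s (- b) * exp_s b = 1.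
Proof. by move=> b1; rewrite -{2}(opprK b) exp_sN //; apply: ordN. Qed.

End Exponential.

(** * Traces *)

Section Trace.
Variables (K : fieldType) (n : nat).
Local Notation ser := (series K n).
Local Notation word := (seq 'I_n).
Implicit Types (a b f g h x : ser) (u v w : word).

(* [tau f = 0] is equivalent to [|f| = 0], up to the constant term of [f]. *)
Definition tau f : ser := fun w => \sum_(i < size w) f (rot i w).

Lemma tauD f g : tau (f + g) = tau f + tau g.
Proof. by apply: serP => w; rewrite serD -big_split. Qed.

Lemma tauZ c f : tau (c *: f) = c *: tau f.
Proof. by apply: serP => w; rewrite serZ mulr_sumr. Qed.

Lemma tauB f g : tau (f - g) = tau f - tau g.
Proof. by rewrite -scaleN1r tauD tauZ scaleN1r. Qed.

Lemma tau_sum I (r : seq I) (P : pred I) (F : I -> ser) :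
  tau (\sum_(i <- r | P i) F i) = \sum_(i <- r | P i) tau (F i).
Proof.
apply: (big_morph tau); first exact: tauD.
by rewrite -(scale0r 0) tauZ !scale0r.
Qed.

Lemma eq_tau_size f g w : (forall w', size w' = size w -> f w' = g w') ->
  tau f w = tau g w.
Proof. by move=> e; apply: eq_bigr => i _; rewrite e ?size_rot. Qed.

Lemma tau_rot1 (F : word -> K) w :
  \sum_(i < size w) F (rot i (rot 1 w)) = \sum_(i < size w) F (rot i w).
Proof.
transitivity (\sum_(i < size w) F (rot i.+1 w)).
  by apply: eq_bigr => i _; rewrite rot_rot -rotS.
apply: (@addrI _ (F (rot 0 w))).
rewrite -(big_ord_recl (size w) (fun i : 'I_(size w).+1 => F (rot i w))).
by rewrite big_ord_recr /= rot_size rot0 addrC.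
Qed.

Lemma tau_rot (F : word -> K) j w : (j <= size w)%N ->
  \sum_(i < size w) F (rot i (rot j w)) = \sum_(i < size w) F (rot i w).
Proof.
elim: j => [|j IH] jw; first by rewrite rot0.
rewrite rotS //; have := tau_rot1 F (rot j w); rewrite size_rot => ->.
by rewrite IH // ltnW.
Qed.

Lemma tau_mulC f g : tau (f * g) = tau (g * f).
Proof.
apply: serP => w; rewrite /tau.
transitivity (\sum_(j < (size w).+1) \sum_(i < size w)
    f (take j (rot i w)) * g (drop j (rot i w))).
  rewrite exchange_big; apply: eq_bigr => i _.
  by rewrite serM /splits size_rot.
transitivity (\sum_(j < (size w).+1) \sum_(i < size w)
    g (take j (rot i w)) * f (drop j (rot i w))); last first.
  rewrite exchange_big; apply: eq_bigr => i _.
  by rewrite serM /splits size_rot.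
(* A cut after [size w - j] letters becomes a cut after [j] letters when the word is rotated by
   [size w - j], and the two factors trade places. *)
rewrite (reindex_inj rev_ord_inj); apply: eq_bigr => j _ /=.
rewrite subSS; have jw : (j <= size w)%N by rewrite -ltnS.
rewrite -(tau_rot (fun v => g (take j v) * f (drop j v)) (leq_subr j _)).
apply: eq_bigr => i _; rewrite rot_rot mulrC.
have : size (rot i w) = size w by rewrite size_rot.
move: (rot i w) => v sv.
have sj : size (drop (size w - j) v) = j by rewrite size_drop sv subKn.
by rewrite /rot take_size_cat ?drop_size_cat.
Qed.

Lemma tau_comm_closure f : in_comm_closure f -> tau f = 0.
Proof.
move=> fcl; apply: serP => w; have [s fs] := fcl (size w).+1.
transitivity (tau (\sum_(pq <- s) (pq.1 * pq.2 - pq.2 * pq.1)) w).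
  by apply: eq_tau_size => w' ww'; rewrite ser_sum fs // ww'.
rewrite tau_sum big1 // => pq _.
by rewrite tauB tau_mulC subrr.
Qed.

Definition letter (c : 'I_n) : ser := fun w => (w == [:: c])%:R.

Lemma hom_letter c : homogeneous 1 (letter c).
Proof. by move=> w sw; rewrite /letter; case: (w =P _) sw => [->|]. Qed.

Lemma letter_prim c : primitive (letter c).
Proof.
apply: primitiveP => // -[|d u] [|e v] // _ _.
rewrite -[RHS](mul0r (coprod (letter c) (d :: u) (e :: v))) -coprodZ.
apply: eq_coprod_size => w sw; rewrite serZ mul0r hom_letter //.
by rewrite sw /= addnS.
Qed.

(** Letters are primitive, so [psi_ad] applies to each summand; this form is therefore visibly
    stable under [psi]. Since the alphabet is finite, no limit of sums is involved. *)
Definition letter_comm f := exists F : 'I_n -> ser,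
  f = \sum_c (letter c * F c - F c * letter c).

Lemma tau_letter_comm f : letter_comm f -> tau f = 0.
Proof.
by move=> [F ->]; rewrite tau_sum big1 // => c _; rewrite tauB tau_mulC subrr.
Qed.

Lemma psi_letter_comm f : letter_comm f -> letter_comm (psi f).
Proof.
move=> [F ->]; exists (fun c => psi (F c)); rewrite psi_sum.
by apply: eq_bigr => c _; rewrite psi_ad //; apply: letter_prim.
Qed.

Lemma letter_sum_l (F : 'I_n -> ser) (a : 'I_n) w :
  (\sum_c letter c * F c) (a :: w) = F a w.
Proof.
rewrite ser_sum (bigD1 a) //= big1 ?addr0 => [|c /negPf ca].
  by rewrite hom1_mull /letter ?eqxx ?mul1r //; apply: hom_letter.
rewrite hom1_mull; last exact: hom_letter.
by rewrite /letter eqseq_cons andbT eq_sym ca mul0r.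
Qed.

Lemma letter_sum_r (F : 'I_n -> ser) (a : 'I_n) w :
  (\sum_c F c * letter c) (rcons w a) = F a w.
Proof.
rewrite ser_sum (bigD1 a) //= big1 ?addr0 => [|c /negPf ca].
  by rewrite hom1_mulr /letter ?eqxx ?mulr1 //; apply: hom_letter.
rewrite hom1_mulr; last exact: hom_letter.
by rewrite /letter eqseq_cons andbT eq_sym ca mulr0.
Qed.

Hypothesis charK : [pchar K] =i pred0.

(* On words of length [m], [f w = H w - H (rot 1 w)] is solved by averaging:
   [H w = - m^-1 * \sum_(i < m) i * f (rot i w)]. *)
Lemma tau0_letter_comm f : f [::] = 0 -> tau f = 0 -> letter_comm f.
Proof.
move=> f0 tf.
pose H w := - ((size w)%:R^-1 * \sum_(i < size w) i%:R * f (rot i w)).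
exists (fun c w => - H (rcons w c)).
apply: serP => w; rewrite sumrB serB.
case: (lastP w) => [|w' b].
  by rewrite f0 !ser_sum !big1 ?subr0 // => c _; rewrite serM0 !hom_letter ?mulr0 ?mul0r.
rewrite (letter_sum_r (fun c w => - H (rcons w c))) opprK.
move: {w}(rcons w' b) (size_rcons w' b) => w sw.
have -> : (\sum_c letter c * (fun w => - H (rcons w c))) w = - H (rot 1 w).
  case: w sw => [//|a w _].
  by rewrite (letter_sum_l (fun c w => - H (rcons w c))) rot1_cons.
have m0 : (size w)%:R != 0 :> K by rewrite sw (natrS_neq0 charK).
pose G i := i%:R * f (rot i w).
(* Adding [tau f (rot 1 w) = 0] raises each weight from [i] to [i + 1], so the rotated sum becomes
   an index shift of the original one. *)
have rotG : \sum_(i < size w) i%:R * f (rot i (rot 1 w))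
    = \sum_(i < size w) G i + (size w)%:R * f w.
  rewrite -[LHS]addr0 -[X in _ + X](congr1 (fun g : ser => g (rot 1 w)) tf).
  rewrite /tau size_rot -big_split /=.
  have -> : (size w)%:R * f w = G (size w) by rewrite /G rot_size.
  rewrite -(big_ord_recr (size w) (fun i : 'I_(size w).+1 => G i)) big_ord_recl.
  rewrite /= {1}/G mul0r add0r; apply: eq_bigr => i _.
  by rewrite /G /bump /= add1n rot_rot -rotS // -natr1 mulrDl mul1r.
rewrite /H size_rot opprK rotG mulrDr mulKf // addrAC subrr add0r //.
Qed.

Lemma iter_psi_exp a i N w : primitive a -> (size w < N)%N ->
  iter i (@psi K n) (exp_s a) w = (\sum_(k < N) (2 ^+ i) ^+ k *: epow k a) w.
Proof.
move=> aP wN; elim: i w wN => [|i IH] w wN.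
  rewrite /= (exp_s_trunc (primitive_ord1 aP) wN) ser_sum.
  by apply: eq_bigr => k _; rewrite expr1n scale1r.
rewrite /= (eq_psi_size (g := \sum_(k < N) (2 ^+ i) ^+ k *: epow k a)).
  rewrite psi_sum !ser_sum; apply: eq_bigr => k _.
  by rewrite psiZ psi_epow // scalerA exprSr exprMn.
by move=> w' ww'; apply: IH; rewrite ww'.
Qed.

(* [psi] acts by [2 ^ k] on [a ^ k] and preserves the span of commutators, so
   the homogeneous parts of the trace of [exp a] in [a] are determined by the
   trace of [exp a]. *)
Lemma tau_epow_eq a z k : primitive a -> primitive z ->
  trace_eq (exp_s a) (exp_s z) -> tau (epow k a) = tau (epow k z).
Proof.
move=> aP zP /tau_comm_closure; rewrite -[sub_s _ _]/(exp_s a - exp_s z) => teq.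
have comm_i i : letter_comm (iter i (@psi K n) (exp_s a - exp_s z)).
  elim: i => [|i IH]; last exact: psi_letter_comm.
  by apply: tau0_letter_comm => //; rewrite /iter serB !exp_s0 subrr.
have iterB i : iter i (@psi K n) (exp_s a - exp_s z)
    = iter i (@psi K n) (exp_s a) - iter i (@psi K n) (exp_s z).
  by elim: i => //= i ->; rewrite psiB.
(* [N] exceeds [size w], which makes the truncation exact at [w], and [k], so that the wanted
   coefficient occurs in [p]. The value of [p] at [2 ^ i] is the trace of the [i]-th iterate of
   [psi], hence [p] has [N] distinct roots: a Vandermonde argument. *)
apply: serP => w; pose N := (maxn (size w) k).+1.
have wN : (size w < N)%N by rewrite ltnS leq_maxl.
pose p := \poly_(j < N) (tau (epow j a) w - tau (epow j z) w).
have root_p i : root p (2 ^+ i).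
  apply/rootP; rewrite horner_poly.
  have := congr1 (fun g : ser => g w) (tau_letter_comm (comm_i i)).
  rewrite iterB tauB serB.
  rewrite (eq_tau_size (g := \sum_(k < N) (2 ^+ i) ^+ k *: epow k a)); last first.
    by move=> w' ww'; apply: iter_psi_exp; rewrite ?ww'.
  rewrite [X in _ - X](eq_tau_size (g := \sum_(k < N) (2 ^+ i) ^+ k *: epow k z)); last first.
    by move=> w' ww'; apply: iter_psi_exp; rewrite ?ww'.
  rewrite !tau_sum !ser_sum -sumrB => eq0; refine (etrans _ eq0); apply: eq_bigr => j _.
  by rewrite !(tauZ (2 ^+ i ^+ j)) !serZ -mulrBr mulrC.
have p0 : p = 0.
  apply: (@roots_geq_poly_eq0 _ _ [seq 2 ^+ i | i <- iota 0 N]).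
  - by apply/allP => _ /mapP [j _ ->].
  - rewrite map_inj_uniq ?iota_uniq // => i1 i2 /=; rewrite -!natrX.
    by move=> /(natr_inj charK) /expnI; apply.
  by rewrite size_map size_iota size_poly.
have kN : (k < N)%N by rewrite ltnS leq_maxr.
by apply/eqP; rewrite -subr_eq0; move/(congr1 (fun q : {poly K} => q`_k)): p0;
  rewrite coef_poly kN coef0 => ->.
Qed.

Lemma tau_pow_eq a z k : primitive a -> primitive z ->
  trace_eq (exp_s a) (exp_s z) -> tau (a ^+ k) = tau (z ^+ k).
Proof.
move=> aP zP /(tau_epow_eq k aP zP); rewrite !tauZ => /(congr1 ( *:%R k`!%:R)).
by rewrite !scalerA divff ?(fact_neq0 charK) // !scale1r.
Qed.

End Trace.

(** * The image of ad x *)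

Section AdImage.
Variables (K : fieldType) (n : nat).
Hypothesis charK : [pchar K] =i pred0.
Local Notation ser := (series K n).
Local Notation word := (seq 'I_n).
Variables (x : ser) (c0 : 'I_n).
Hypotheses (x1 : homogeneous 1 x) (xc0 : x [:: c0] != 0).
Implicit Types (f g h t u : ser) (v w : word).

(* A left factor [x] can be moved to the right modulo the image of [ad x];
   [c0] detects left factors [x]. *)
Lemma strip_ad m u : homogeneous m u -> exists t u0 k,
  [/\ u = u0 + k *: x ^+ m + (x * t - t * x), homogeneous m u0,
      forall w, u0 (c0 :: w) = 0 & u0 [::] = 0].
Proof.
elim: m u => [|m IH] u um.
  exists 0, 0, (u [::]); split=> //; rewrite mulr0 mul0r subrr addr0 add0r.
  apply: serP => -[|c w]; first by rewrite serZ mulr1.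
  by rewrite um // serZ mulr0.
pose du := (x [:: c0])^-1 *: lder c0 u.
have dum : homogeneous m du by move=> w wm; rewrite /du serZ [lder _ _ _]um ?mulr0.
have [t [v0 [k [duE v0m v0c v00]]]] := IH _ dum.
(* No word of [u - x * du] starts with [c0]. The rest is [x * du = du * x + [x, du]]; the induction
   hypothesis decomposes [du], and [[x, t] * x = [x, t * x]]. *)
exists (t * x + du), (u - x * du + v0 * x), k; split.
- have duxE : du * x = v0 * x + k *: x ^+ m.+1 + (x * t * x - t * x * x).
    by rewrite {1}duE !mulrDl mulNr -scalerAl -exprSr.
  apply: serP => w; rewrite mulrDr mulrDl duxE !mulrA.
  by rewrite !(serD, serN); ring.
- move=> w wm; rewrite serD serB um // sub0r.
  rewrite -(addn1 m) in wm.
  by rewrite (homM v0m x1) // addr0 (homM x1 dum) ?oppr0 // addnC.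
- move=> w; rewrite serD serB hom1_mull // /du serZ mulrA divff // mul1r subrr add0r.
  case: (lastP w) => [|w' a].
    by rewrite (hom1_mulr v0 c0 [::] x1) v00 mul0r.
  by rewrite -rcons_cons hom1_mulr // v0c mul0r.
rewrite serD serB !serM0 um // hom1_nil // v00.
by rewrite !mul0r subrr addr0.
Qed.

(** After [strip_ad] it remains to kill [k] and [u0]. The words tested have length [2m] and end in
    at least [m] letters [c0], so a window of [m] letters starting in the other part never wraps
    around to the beginning. *)
Lemma tau_pow_ad m u : (0 < m)%N -> homogeneous m u ->
  (forall w, size w = (m + m)%N -> tau (u * x ^+ m) w = 0) ->
  exists t, u = x * t - t * x.
Proof.
move=> m0 um tu; have [t [u0 [k [uE u0m u0c u00]]]] := strip_ad um.
have u0nseq p q w : (0 < p)%N -> u0 (take q (nseq p c0 ++ w)) = 0.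
  by case: p q => [//|p] [|q] _; rewrite /= ?u00 ?u0c.
have xm := homX (k := m) x1.
have xnseq p : (x ^+ p) (nseq p c0) = x [:: c0] ^+ p.
  by elim: p => [|p IHp] //; rewrite !exprS hom1_mull // IHp.
have tauE w : size w = (m + m)%N ->
    tau (u0 * x ^+ m) w + k * tau (x ^+ (m + m)) w = 0.
  move=> /tu; rewrite uE mulrDl tauD mulrDl tauD -scalerAl -exprD tauZ.
  have -> : (x * t - t * x) * x ^+ m = x * (t * x ^+ m) - (t * x ^+ m) * x.
    by rewrite mulrBl -!mulrA -exprS -exprSr.
  by rewrite tauB (tau_mulC x) subrr addr0.
have u0x w : size w = (m + m)%N ->
    (u0 * x ^+ m) w = u0 (take m w) * (x ^+ m) (drop m w).
  by move=> wm; rewrite (mul_homl _ u0m) // wm leq_addl.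
(* On the constant word [c0 ^ 2m] the terms in [u0] vanish, which leaves [k] times [2m] times a
   power of [x [:: c0]]. *)
have k0 : k = 0.
  have := tauE (nseq (m + m) c0) (size_nseq _ _).
  have rotn i : rot i (nseq (m + m) c0) = nseq (m + m) c0.
    have /all_pred1P : all (pred1 c0) (rot i (nseq (m + m) c0)).
      by rewrite (eq_all_r (mem_rot i _)) all_nseq /= eqxx orbT.
    by rewrite size_rot size_nseq.
  rewrite /tau big1 => [|i _]; last first.
    rewrite rotn u0x ?size_nseq // -[nseq _ _]cats0 u0nseq ?mul0r //.
    by rewrite addn_gt0 m0.
  rewrite add0r; under eq_bigr => i _ do rewrite rotn xnseq.
  rewrite sumr_const card_ord size_nseq -mulr_natl => /eqP; rewrite !mulf_eq0.
  rewrite expf_eq0 (negPf xc0) andbF orbF => /orP [/eqP //|].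
  by have /pcharf0P -> := charK; move=> /eqP; lia.
(* For [v] of length [r], among the rotations of [v ++ c0 ^ (2m - r)] only those
   starting inside [v] contribute, and all but the first one involve a
   coefficient of [u0] with more trailing letters [c0]. *)
have u0P r v : size v = r -> (r <= m)%N -> u0 (v ++ nseq (m - r) c0) = 0.
  elim/ltn_ind: r v => r IH v vr rm.
  case: (posnP r) => [r0|r0].
    by rewrite r0 in vr *; rewrite (size0nil vr) subn0; case: (m) m0 => //= p _; apply: u0c.
  pose W := v ++ nseq (m - r + m) c0.
  have sW : size W = (m + m)%N by rewrite size_cat size_nseq vr; lia.
  have := tauE W sW; rewrite k0 mul0r addr0 /tau sW.
  have m2 : (0 < m + m)%N by lia.
  rewrite (bigD1 (Ordinal m2)) //= rot0 big1 ?addr0 => [|i i0]; last first.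
    rewrite u0x ?size_rot //.
    have {i0} : (0 < i)%N by rewrite lt0n; apply: contra i0 => /eqP i0; apply/eqP/val_inj.
    move=> i0; case: (ltnP i r) => ir.
      suff -> : take m (rot i W) = drop i v ++ nseq (m - (r - i)) c0.
        by rewrite (IH (r - i)%N) ?mul0r ?size_drop ?vr //; lia.
      rewrite /rot /W drop_cat vr ir -catA take_cat size_drop vr ltnNge.
      have -> : (r - i <= m)%N by lia.
      by rewrite /= take_cat size_nseq; case: ltnP => [_|]; [rewrite take_nseq //; lia | lia].
    rewrite /rot /W drop_cat vr ltnNge ir /= drop_nseq u0nseq ?mul0r //.
    by have := ltn_ord i; lia.
  rewrite u0x // /W take_cat vr drop_cat vr.
  case: ltnP => [mr|_]; first by lia.
  rewrite take_nseq ?drop_nseq; last by lia.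
  have -> : (m - r + m - (m - r) = m)%N by lia.
  move/eqP; rewrite mulf_eq0 xnseq expf_eq0 (negPf xc0) andbF orbF => /eqP //.
suff u00' : u0 = 0 by exists t; rewrite {1}uE u00' k0 scale0r !add0r.
apply: serP => w; case: (altP (size w =P m)) => [wm|/u0m //].
by have := u0P m w wm (leqnn m); rewrite subnn cats0.
Qed.

End AdImage.

(** * Projection onto primitive elements *)

Section Euler.
Variables (K : fieldType) (n : nat).
Hypothesis charK : [pchar K] =i pred0.
Local Notation ser := (series K n).
Local Notation word := (seq 'I_n).
Implicit Types (f g h t u x : ser) (v w : word).

(* [f] vanishes on the [k]-th power of the augmentation ideal of the shuffle
   algebra. *)
Fixpoint coradical k f : Prop :=
  if k is k'.+1 then forall v, v != [::] -> coradical k' (coprod f v)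
  else forall w, f w = 0.

Lemma eq_coradical k f g : f =1 g -> coradical k f -> coradical k g.
Proof. by move=> /serP ->. Qed.

Lemma coradicalD k f g : coradical k f -> coradical k g -> coradical k (f + g).
Proof.
elim: k f g => [|k IH] f g /= fk gk; first by move=> w; rewrite serD fk gk addr0.
move=> v v0; apply: eq_coradical (IH _ _ (fk v v0) (gk v v0)) => w.
by rewrite coprodD.
Qed.

Lemma coradicalZ k c f : coradical k f -> coradical k (c *: f).
Proof.
elim: k f => [|k IH] f /= fk; first by move=> w; rewrite serZ fk mulr0.
by move=> v v0; apply: eq_coradical (IH _ (fk v v0)) => w; rewrite coprodZ.
Qed.

Lemma coradical0 k : coradical k (0 : ser).
Proof.
elim: k => [|k IH] //= v _; apply: eq_coradical (IH) => w.
by rewrite coprod0.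
Qed.

Lemma coradicalW k f : coradical k f -> coradical k.+1 f.
Proof.
elim: k f => [|k IH] f fk v v0; last exact/IH/fk.
by move=> w; rewrite (eq_coprod (g := 0 *: f)) ?coprodZ ?mul0r // => y; rewrite fk serZ mul0r.
Qed.

Lemma coradical_sum k I (r : seq I) (P : pred I) (F : I -> ser) :
  (forall i, P i -> coradical k (F i)) -> coradical k (\sum_(i <- r | P i) F i).
Proof.
move=> FP; apply: (big_ind (coradical k)) => //; first exact: coradical0.
exact: coradicalD.
Qed.

(** [psi] acts by [2 ^ k] on the [k]-th graded piece of the filtration. In the coproduct of [psi f]
    at a nonempty word, the two end cuts each give [psi g] with [g] one step lower, which doubles
    the eigenvalue; the inner cuts fall into a lower step. *)
Lemma coradical_psi k f : coradical k.+1 f -> coradical k (psi f - 2 ^+ k *: f).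
Proof.
elim: k f => [|k IH] f fk.
  move=> w; rewrite expr0 scale1r serB.
  have f0 c w' : f (c :: w') = 0 by rewrite -(coprod_nilr f) fk.
  case: w => [|c w]; first by rewrite /psi splits_nil coprod_nill subrr.
  rewrite f0 subr0 /psi splits_ends coprod_nill coprod_nilr f0 !add0r.
  by rewrite big1 // => i _; rewrite fk.
have psiW g : coradical k g -> coradical k (psi g).
  move=> gk; rewrite -(subrK (2 ^+ k *: g) (psi g)); apply: coradicalD.
    exact/IH/coradicalW.
  exact: coradicalZ.
case=> [//|c v] v0; rewrite -/(coradical k _).
pose g : ser := coprod f (c :: v).
suff <- : (psi g - 2 ^+ k *: g) + (psi g - 2 ^+ k *: g)
   + \sum_(i < size v) psi (coprod (coprod f (c :: take i v)) (drop i v))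
   = coprod (psi f - 2 ^+ k.+1 *: f) (c :: v) :> ser.
  apply: coradicalD; first by apply: coradicalD; apply/IH/fk.
  apply: coradical_sum => i _; apply: psiW.
  apply: (fk (c :: take i v)) => //.
  by rewrite -size_eq0 size_drop subn_eq0 -ltnNge ltn_ord.
apply: serP => w; rewrite coprodB coprodZ coprod_psi splits_ends !serD !serN !serZ ser_sum.
rewrite (eq_psi (f := coprod (coprod f [::]) (c :: v)) (g := g)); last first.
  by move=> w'; apply: eq_coprod => w''; rewrite coprod_nill.
rewrite (eq_psi (f := coprod (coprod f (c :: v)) [::]) (g := g)).
  by rewrite exprS /g; ring.
by move=> w'; rewrite coprod_nill.
Qed.

Lemma hom_coradical m f : (forall w, (m <= size w)%N -> f w = 0) -> coradical m f.
Proof.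
elim: m f => [|m IH] f fm; first by move=> w; apply: fm.
move=> v v0; apply: IH => w mw; rewrite -[RHS](mul0r (coprod f v w)) -coprodZ.
apply: eq_coprod_size => y yE; rewrite serZ mul0r fm // yE.
by rewrite -size_eq0 -lt0n in v0; rewrite -addn1 addnC leq_add.
Qed.

(* The product of the [(psi - 2 ^ k) / (2 - 2 ^ k)] projects onto the Lie part
   and commutes with [ad x]. *)
Lemma ad_lie_witness k x t u : primitive x -> primitive u ->
  coradical k.+2 t -> u = x * t - t * x ->
  exists2 t', coradical 2 t' & u = x * t' - t' * x.
Proof.
move=> xP uP; elim: k t => [|k IH] t tk uE; first by exists t.
(* The scalar by which [psi - 2 ^ k.+2] acts on the primitive [u]. *)
pose d : K := 2 - 2 ^+ k.+2.
have d0 : d != 0.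
  rewrite /d subr_eq0 -!natrX (inj_eq (natr_inj charK)).
  by rewrite -{1}(expn1 2) eqn_exp2l.
apply: (IH (d^-1 *: (psi t - 2 ^+ k.+2 *: t))).
  exact/coradicalZ/coradical_psi.
rewrite -scalerAr -scalerAl -scalerBr mulrBr mulrBl.
rewrite -scalerAr -scalerAl opprD addrACA -psi_ad // -opprD -scalerBr -uE.
rewrite psi_prim // -mulr2n -scaler_nat -scalerBl scalerA mulVf ?scale1r //.
Qed.

Lemma lie_ad m x u c0 : homogeneous 1 x -> primitive x -> x [:: c0] != 0 ->
  homogeneous m.+2 u -> primitive u ->
  (forall w, size w = (m.+2 + m.+2)%N -> tau (u * x ^+ m.+2) w = 0) ->
  exists t, [/\ homogeneous m.+1 t, primitive t & u = x * t - t * x].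
Proof.
move=> x1 xP xc um uP tu.
have hadE t : u = x * t - t * x ->
    u = x * hcomp m.+1 t - hcomp m.+1 t * x.
  move=> uE; apply: serP => w; rewrite serB.
  case: (altP (size w =P m.+2)) => [wm|wm].
    rewrite {1}uE serB (mul_homl _ x1) ?(mul_homr _ x1) ?wm //.
    rewrite (mul_homl _ x1) ?(mul_homr _ x1) ?wm //.
    by rewrite /hcomp size_drop size_takel wm ?subn1 //= ?eqxx.
  rewrite um //; have tm := hom_hcomp (m := m.+1) t.
  by rewrite (homM x1 tm) ?(homM tm x1) ?subr0 ?addn1.
have [t /hadE uE] := tau_pow_ad charK x1 xc (ltn0Sn _) um tu.
(* A shuffle of [m.+2] nonempty words has length above [m.+1]: this starts the descent to
   [coradical 2], which is primitivity up to the constant term. *)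
have tk : coradical m.+2 (hcomp m.+1 t).
  by apply: hom_coradical => w mw; apply: hom_hcomp; rewrite gtn_eqF.
have [t' t'2 /hadE uE'] := ad_lie_witness xP uP tk uE.
exists (hcomp m.+1 t'); split=> //; first exact: hom_hcomp.
apply: primitiveP => // v w v0 w0.
by rewrite coprod_hcomp -coprod_nilr t'2 // if_same.
Qed.

End Euler.

(** * Leading terms *)

Section Leading.
Variables (K : fieldType) (n : nat).
Local Notation ser := (series K n).
Implicit Types (a b c f g h t u x z : ser).

(** [f'] may be zero or inhomogeneous; a congruence modulo order [p.+1] is stable under sums and
    products without case distinctions. *)
Definition lead p f f' := ord p f' /\ ord p.+1 (f - f').

Lemma lead_ord p f f' : lead p f f' -> ord p f.
Proof.
by move=> [f'p ffp]; rewrite -(subrK f' f); apply: ordD => //; apply: ordW ffp.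
Qed.

Lemma leadM p q f f' g g' :
  lead p f f' -> lead q g g' -> lead (p + q)%N (f * g) (f' * g').
Proof.
move=> Hf [g'q gg]; have fp := lead_ord Hf; case: Hf => f'p ff.
split; first exact: ordM.
have -> : f * g - f' * g' = f * (g - g') + (f - f') * g'.
  by rewrite mulrBr mulrBl addrA subrK.
by apply: ordD; [rewrite -addnS; apply: ordM | rewrite -addSn; apply: ordM].
Qed.

Lemma leadD p f f' g g' : lead p f f' -> lead p g g' -> lead p (f + g) (f' + g').
Proof.
move=> [f'p ff] [g'q gg]; split; first exact: ordD.
by rewrite opprD addrACA; apply: ordD.
Qed.

Lemma lead_refl p f : ord p f -> lead p f f.
Proof. by move=> fp; split=> //; rewrite subrr. Qed.

Lemma leadX f x k : lead 1 f x -> lead k (f ^+ k) (x ^+ k).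
Proof.
move=> fx; elim: k => [|k IH]; first exact: lead_refl.
by rewrite !exprS -add1n; apply: leadM.
Qed.

(* [mixed x u k] is [\sum_(i <= k) x ^ i * u * x ^ (k - i)], the first variation
   of [x ^ k.+1] in the direction [u]. *)
Fixpoint mixed x u k : ser :=
  if k is k'.+1 then x * mixed x u k' + u * x ^+ k else u.

(** Each of the [k.+1] summands rotates to the same cyclic word. The prefix [x ^+ j] is there for
    the induction. *)
Lemma tau_mixed x u j k :
  tau (x ^+ j * mixed x u k) = k.+1%:R *: tau (u * x ^+ (j + k)%N).
Proof.
elim: k j => [|k IH] j; first by rewrite tau_mulC addn0 scale1r.
rewrite [mixed _ _ _]/= mulrDr tauD mulrA -exprSr IH addSnnS.
rewrite (tau_mulC (x ^+ j)) -mulrA -exprD (addnC _ j).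
by rewrite -[X in _ + X]scale1r -scalerDl natr1.
Qed.

Lemma lead_mixed m a c x u k : lead 1 a x -> lead 1 c x -> lead m (a - c) u ->
  lead (k + m)%N (a ^+ k.+1 - c ^+ k.+1) (mixed x u k).
Proof.
move=> ax cx du; elim: k => [|k IH] //.
have -> : a ^+ k.+2 - c ^+ k.+2
    = a * (a ^+ k.+1 - c ^+ k.+1) + (a - c) * c ^+ k.+1.
  by rewrite mulrBr mulrBl -!exprS addrA subrK.
rewrite [mixed _ _ _]/=; apply: leadD; first by rewrite addSn -add1n; apply: leadM.
by rewrite addnC; apply: leadM => //; apply: leadX.
Qed.

Lemma ord_sub_pow q b b' k : ord q (b - b') -> ord q (b ^+ k - b' ^+ k).
Proof.
move=> bb; elim: k => [|k IH]; first by rewrite subrr.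
have -> : b ^+ k.+1 - b' ^+ k.+1 = b * (b ^+ k - b' ^+ k) + (b - b') * b' ^+ k.
  by rewrite mulrBr mulrBl -!exprS addrA subrK.
apply: ordD; first by apply: (ordM (@ord_zero _ _ b)).
by rewrite -[q]addn0; apply: ordM => //; apply: ord_zero.
Qed.

Lemma ord_sub_exp q b b' : ord q (b - b') -> ord q (exp_s b - exp_s b').
Proof.
move=> bb w wq; rewrite serB !exp_sE -sumrB big1 // => k _.
by rewrite /epow !serZ -mulrBr -serB (ord_sub_pow _ bb) ?mulr0.
Qed.

Lemma ord_pow_perturb m b w k : ord 1 b -> ord m.+1 w ->
  ord (m.+1 + k)%N ((b + w) ^+ k.+1 - b ^+ k.+1).
Proof.
move=> b1 wm; have bw1 : ord 1 (b + w) by apply: ordD => //; apply: ordW wm.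
elim: k => [|k IH]; first by rewrite addn0 !expr1 addrC addKr.
have -> : (b + w) ^+ k.+2 - b ^+ k.+2
    = (b + w) * ((b + w) ^+ k.+1 - b ^+ k.+1) + w * b ^+ k.+1.
  by rewrite mulrBr -!exprS mulrDl -exprS opprD addrA addrNK.
apply: ordD; first by rewrite addnS -add1n; apply: ordM.
by apply: ordM => //; apply: ordX.
Qed.

Lemma ord_exp_perturb m b w : ord 1 b -> ord m.+1 w ->
  ord m.+2 (exp_s (b + w) - (exp_s b + w)).
Proof.
move=> b1 wm v vm; have bw1 : ord 1 (b + w) by apply: ordD => //; apply: ordW wm.
rewrite serB serD (exp_s_trunc b1 vm) (exp_s_trunc bw1 vm) opprD addrA -sumrB.
rewrite big_ord_recl big_ord_recl /= big1 => [|k _].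
  by rewrite /epow /= fact0 invr1 !scale1r !expr0 subrr !expr1 serD; ring.
rewrite /bump /= !add1n /epow !serZ -mulrBr -serB.
rewrite (ord_pow_perturb b1 wm) ?mulr0 //.
by apply: leq_trans vm _; rewrite addnS ltnS addSn ltnS leq_addr.
Qed.

Lemma conj_pow g h z k : h * g = 1 -> g * h = 1 ->
  (g * z * h) ^+ k = g * z ^+ k * h.
Proof.
move=> hg gh; elim: k => [|k IH]; first by rewrite mulr1.
by rewrite !exprS IH !mulrA -[_ * h * g]mulrA hg mulr1.
Qed.

End Leading.

(** * Construction of the conjugating element *)

Section Conjugation.
Variables (K : fieldType) (n : nat).
Hypothesis charK : [pchar K] =i pred0.
Local Notation ser := (series K n).
Variables (a z : ser) (c0 : 'I_n).
Hypotheses (aP : primitive a) (zP : primitive z) (zc0 : z [:: c0] != 0).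
Hypothesis tr_az : trace_eq (exp_s a) (exp_s z).
Implicit Types (b t u : ser).

Local Notation x := (hcomp 1 z).

(** The conjugation equation cleared of the inverse, hence linear in [exp_s b]. *)
Definition defect b : ser := a * exp_s b - exp_s b * z.

Lemma lead_z : lead 1 z x.
Proof.
split; first by apply: hom_ord; apply: hom_hcomp.
by apply: ord_hcomp; apply: primitive_ord1.
Qed.

(** A one-letter word has a single rotation, so the trace determines the linear part. *)
Lemma ord_sub_az : ord 2 (a - z).
Proof.
move=> [|c [|//]] _; rewrite serB ?primitive0 ?subrr //.
have := congr1 (fun f : ser => f [:: c]) (tau_pow_eq charK 1 aP zP tr_az).
by rewrite !expr1 /tau !big_ord1 => ->; rewrite subrr.
Qed.

Lemma lead_a : lead 1 a x.
Proof.
have [x1 zx] := lead_z; split => //.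
by rewrite -(subrK z a) -addrA; apply: ordD => //; apply: ord_sub_az.
Qed.

(** The defect is skew-primitive relative to the group-like [exp_s b]. In its lowest degree both
    factors of a proper cut are too short to contribute, so the leading term is primitive. *)
Lemma coprod_defect b v w : primitive b ->
  coprod (defect b) v w = defect b v * exp_s b w + exp_s b v * defect b w.
Proof.
move=> bP; rewrite /defect coprodB coprod_primMl // coprod_primMr //.
under eq_splits => ? ? _ do rewrite exp_coprod // mulrA.
under [X in _ + X - _]eq_splits => ? ? _ do rewrite exp_coprod // mulrCA.
under [X in _ - (X + _)]eq_splits => ? ? _ do rewrite exp_coprod // mulrAC.
under [X in _ - (_ + X)]eq_splits => ? ? _ do rewrite exp_coprod // -mulrA.
by rewrite !splitsMl !splitsMr -!serM !serB; ring.
Qed.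

Lemma primitive_lead_defect m b : primitive b -> ord m (defect b) ->
  primitive (hcomp m (defect b)).
Proof.
move=> bP em; apply: primitiveP => [|v w v0 w0].
  by rewrite /hcomp; case: eqP => // _; rewrite /defect serB !serM0 (primitive0 aP)
    (primitive0 zP) mul0r mulr0 subrr.
rewrite coprod_hcomp coprod_defect //; case: eqP => // vw.
rewrite (em v) ?(em w) ?mul0r ?mulr0 ?addr0 // -vw.
  by rewrite -[X in (X < _)%N]add0n ltn_add2r lt0n size_eq0.
by rewrite -[X in (X < _)%N]addn0 ltn_add2l lt0n size_eq0.
Qed.

Lemma tau_lead_defect m b v : primitive b -> ord m.+2 (defect b) ->
  size v = (m.+2 + m.+2)%N ->
  tau (hcomp m.+2 (defect b) * x ^+ m.+2) v = 0.
Proof.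
move=> bP em sv; set u := hcomp _ _; have b1 := primitive_ord1 bP.
set g := exp_s b in em *; pose h := exp_s (- b).
have gh : g * h = 1 by apply: exp_sN.
have hg : h * g = 1 by apply: exp_sNK.
(* Powers of [c] have the same trace as those of [z], and [a - c] has the leading term of the defect
   because [h] has constant term 1. *)
pose c := g * z * h.
have acE : a - c = defect b * h by rewrite mulrBl -mulrA gh mulr1.
have ac : lead m.+2 (a - c) u.
  rewrite acE -[u]mulr1 -[m.+2]addn0; apply: leadM.
    split; [by apply: hom_ord; apply: hom_hcomp | by apply: ord_hcomp].
  by split => //; apply: ord1P; rewrite /h serB exp_s0 subrr.
have cx : lead 1 c x.
  have [x1 ax] := lead_a; split => //.
  have -> : c - x = (a - x) - (a - c) by rewrite opprB [RHS]addrC addrA subrK.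
  by apply: ordB => //; apply: ordW (lead_ord ac).
have [_ dm] := lead_mixed m.+2 lead_a cx ac.
have : tau (a ^+ m.+3 - c ^+ m.+3) = 0.
  rewrite tauB /c conj_pow // (tau_mulC _ h) mulrA hg mul1r.
  by rewrite (tau_pow_eq charK _ aP zP tr_az) subrr.
move=> /(congr1 (fun f : ser => f v)).
rewrite (eq_tau_size (g := mixed x u m.+2)); last first.
  by move=> w wv; apply/eqP; rewrite -subr_eq0 -serB dm // wv sv.
rewrite -[mixed _ _ _]mul1r -(expr0 x) tau_mixed serZ add0n => /eqP.
by rewrite mulf_eq0 (negPf (natrS_neq0 charK _)) => /eqP.
Qed.

Lemma defect_step m b : primitive b -> ord m.+2 (defect b) ->
  exists t, [/\ primitive t, homogeneous m.+1 t & ord m.+3 (defect (b + t))].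
Proof.
move=> bP em; have b1 := primitive_ord1 bP; pose u := hcomp m.+2 (defect b).
have [||||t [tm tP uE]] := @lie_ad _ _ charK m x u c0 _ _ _ _
    (primitive_lead_defect bP em) (fun v => tau_lead_defect bP em (v := v)).
- exact: hom_hcomp.
- exact: primitive_hcomp.
- exact: zc0.
- exact: hom_hcomp.
exists (- t); have t1 := ordN (hom_ord tm); split; first exact: primitiveN.
  by move=> v vm; rewrite serN tm ?oppr0.
pose r := exp_s (b - t) - (exp_s b - t).
have rm : ord m.+2 r by apply: ord_exp_perturb.
have [_ ax] := lead_a; have [_ zx] := lead_z.
(* Passing from [b] to [b - t] adds [t * z - a * t] up to [r]; its lowest part is [- [x, t] = -
   u]. *)
have -> : defect (b - t) = (defect b - u) + (t * (z - x) - (a - x) * t)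
                            + (a * r - r * z).
  have rE : exp_s (b - t) = exp_s b - t + r by rewrite /r [RHS]addrC subrK.
  rewrite /defect rE {1}uE !(mulrDl, mulrDr, mulrBl, mulrBr, mulNr, mulrN).
  by apply: serP => v; rewrite !(serD, serN); ring.
apply: ordD; first apply: ordD; first exact: ord_hcomp.
  apply: ordB; last by rewrite -[m.+3]/(2 + m.+1)%N; apply: ordM => //; apply: hom_ord.
  have -> : m.+3 = (m.+1 + 2)%N by rewrite addn2.
  by apply: ordM => //; apply: hom_ord.
apply: ordB; first by rewrite -[m.+3]/(1 + m.+2)%N; apply: ordM => //; apply: primitive_ord1.
have -> : m.+3 = (m.+2 + 1)%N by rewrite addn1.
by apply: ordM => //; apply: primitive_ord1.
Qed.

Lemma conj_exists : exists2 b, primitive b & a * exp_s b = exp_s b * z.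
Proof.
pose good m b := primitive b /\ ord m.+2 (defect b).
(* The implication sits under the existential so that [t] can be chosen for every [b] and the
   recursion [B] carries no proof. *)
have step m b : exists t, good m b ->
    [/\ primitive t, homogeneous m.+1 t & ord m.+3 (defect (b + t))].
  case: (EM (good m b)) => [[bP em]|nb]; last by exists 0.
  by have [t tP] := defect_step bP em; exists t.
pose B := fix B m : ser :=
  if m is m'.+1 then B m' + projT1 (cid (step m' (B m'))) else 0.
have B0 : good 0 0.
  split; first exact: primitive_0.
  have -> : defect 0 = a - z by rewrite /defect exp_s0E mulr1 mul1r.
  exact: ord_sub_az.
have Bgood m : good m (B m).
  elim: m => [|m IH] //; rewrite /good [B _]/=.
  case: cid => t /= /(_ IH) [tP _ em]; split=> //.
  by apply: primitiveD => //; case: IH.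
have Bstable m p w : (size w <= m)%N -> B (m + p)%N w = B m w.
  move=> wm; elim: p => [|p IH]; first by rewrite addn0.
  rewrite addnS [B _.+1]/=; case: cid => t /= /(_ (Bgood _)) [_ tm _].
  rewrite serD IH tm ?addr0 //; lia.
(* The limit is a diagonal: stage [m] adds only words of length [m.+1]. *)
pose b : ser := fun w => B (size w) w.
have bB m : ord m.+1 (b - B m).
  move=> w wm; rewrite serB /b -(subnKC (wm : (size w <= m)%N)).
  by rewrite Bstable ?subrr.
exists b.
  move=> u v; pose m := (size u + size v)%N; have [BP _] := Bgood m.
  have bE w : (size w <= m)%N -> b w = B m w.
    by move=> wm; apply/eqP; rewrite -subr_eq0 -serB bB.
  rewrite (eq_coprod_size (g := B m)); last by move=> w wE; rewrite bE // wE.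
  by rewrite BP !bE ?leq_addl ?leq_addr.
apply/eqP; rewrite -subr_eq0; apply/eqP; apply: serP => w.
pose m := size w; have [_ em] := Bgood m.
have eb := ord_sub_exp (bB m); set d := (_ - _) in eb.
have -> : a * exp_s b - exp_s b * z = defect (B m) + (a * d - d * z).
  have dE : exp_s b = exp_s (B m) + d by rewrite /d [RHS]addrC subrK.
  by rewrite /defect dE mulrDl mulrDr opprD addrACA.
have a1 := primitive_ord1 aP; have z1 := primitive_ord1 zP.
rewrite serD serB em ?(ordM a1 eb) ?(ordM eb z1) ?subrr ?addr0 //; rewrite /m; lia.
Qed.

End Conjugation.

Theorem theorem3p4 (K : fieldType) (n : nat)
  (charK : [pchar K] =i pred0)
  (z a : series K n)
  (hz : primitive z) (hzlin : ~ in_higher_Lie z)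
  (ha : primitive a)
  (htr : trace_eq (exp_s a) (exp_s z)) :
  exists g : series K n,
    (exists b : series K n, primitive b /\ g = exp_s b) /\
    exists ginv : series K n,
      mul_s g ginv = @one_s K n /\ mul_s ginv g = @one_s K n /\
      a = mul_s (mul_s g z) ginv.
Proof.
(* Homogeneous components of a primitive series are primitive, so only a nonzero linear coefficient
   can violate [in_higher_Lie]. *)
have [c zc] : exists c, z [:: c] != 0.
  apply: contrapT => nz; apply: hzlin; split=> [l _|]; first exact: primitive_hcomp.
  case=> [|c [|//]] _; first exact: primitive0.
  by apply/eqP; apply: contrapT => /negP zc; apply: nz; exists c.
have [b bP abE] := conj_exists charK ha hz zc htr.
have b1 := primitive_ord1 bP.
have gh : exp_s b * exp_s (- b) = 1 by apply: exp_sN.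
have hg : exp_s (- b) * exp_s b = 1 by apply: exp_sNK.
exists (exp_s b); split; first by exists b.
exists (exp_s (- b)); split=> //; split=> //.
by rewrite -[RHS]/(exp_s b * z * exp_s (- b)) -abE -mulrA gh mulr1.
Qed.
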